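(* Let $T$ be a complete dependent theory with monster model $\mathfrak{C}$. Let $M$ be a model of $T$ (a small elementary submodel of $\mathfrak{C}$) and let $p\in S(M)$. Then there exists a global heir of $p$ (a complete type over $\mathfrak{C}$ which is an heir of $p$) which does not fork over $M$.
   Context: $T$ is a complete dependent (NIP) first-order theory, $T=T^{eq}$, with monster model $\mathfrak{C}$. A global type $q\supseteq p$ is an heir of $p\in S(M)$ if for every formula $\varphi(x,y)$ over $M$ and every $c\in\mathfrak{C}$ with $\varphi(x,c)\in q$ there is $m\in M$ with $\varphi(x,m)\in p$. *)

(* Defs.v *)
From mathcomp Require Import all_boot.
From mathcomp Require Import boolp classical_sets functions cardinality.
From Stdlib Require Import RelationClasses.

Set Implicit Arguments.
Unset Strict Implicit.
Unset Printing Implicit Defensive.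

Local Open Scope classical_set_scope.
Local Open Scope card_scope.

(** * Many-sorted first-order logic

    Logic is many-sorted so that theories with [T = T^eq] are covered.  The shape
    of a finite tuple of variables is a finite binary tree of sorts, the
    variables being its leaves; a [ctx] serves as the arity of a symbol, as the
    free variables of a formula, and as the shape of a tuple of elements.  With
    trees, variables of a concatenation are literally a sum type. *)

Inductive ctx (S : Type) : Type :=
| CNil
| COne (s : S)
| CCat (X Y : ctx S).

Arguments CNil {S}.

Fixpoint var (S : Type) (X : ctx S) : Set :=
  match X with
  | CNil => Empty_set
  | COne _ => unit
  | CCat X Y => (var X + var Y)%type
  end.

Fixpoint vsort (S : Type) (X : ctx S) : var X -> S :=
  match X with
  | CNil => fun v => match v with end
  | COne s => fun _ => s
  | CCat X Y => fun v => match v with inl x => vsort x | inr y => vsort y end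
  end.

Record signature := Signature {
  lsort : Type;
  fsym : Type;
  fdom : fsym -> ctx lsort;
  fcod : fsym -> lsort;
  rsym : Type;
  rdom : rsym -> ctx lsort }.

Inductive term (L : signature) (X : ctx (lsort L)) : lsort L -> Type :=
| Var (v : var X) : term X (vsort v)
| App (f : fsym L) (t : forall v : var (fdom f), term X (vsort v)) :
    term X (fcod f).

Inductive formula (L : signature) (X : ctx (lsort L)) : Type :=
| FBot
| FEq (s : lsort L) (t1 t2 : term X s)
| FRel (r : rsym L) (t : forall v : var (rdom r), term X (vsort v))
| FImp (f g : formula X)
| FAll (s : lsort L) (f : formula (CCat X (COne s))).

Arguments FBot {L X}.

Definition FNot (L : signature) (X : ctx (lsort L)) (f : formula X) :=
  FImp f FBot.

Definition sentence (L : signature) := formula (@CNil (lsort L)).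

Definition assignment (S : Type) (D : S -> Type) (X : ctx S) :=
  forall v : var X, D (vsort v).

Record structure (L : signature) := Structure {
  carrier :> lsort L -> Type;
  carrier_inh : forall s, inhabited (carrier s);
  fint : forall f : fsym L, assignment carrier (fdom f) -> carrier (fcod f);
  rint : forall r : rsym L, assignment carrier (rdom r) -> Prop }.

(** [tup N X]: the [X]-shaped finite tuples of elements of [N]. *)
Definition tup (L : signature) (N : structure L) (X : ctx (lsort L)) :=
  assignment N X.

Section Semantics.
Variables (L : signature) (N : structure L).
Implicit Types X Y : ctx (lsort L).

Definition tnil : tup N (@CNil (lsort L)) := fun v => match v with end.

Definition tone (s : lsort L) (z : N s) : tup N (COne s) := fun _ => z.

Definition tcat X Y (a : tup N X) (b : tup N Y) : tup N (CCat X Y) :=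
  fun v => match v with inl x => a x | inr y => b y end.

Fixpoint eval X (a : tup N X) (s : lsort L) (t : term X s) : N s :=
  match t with
  | Var v => a v
  | App f u => @fint L N f (fun v => eval a (u v))
  end.

Fixpoint sat X (f : formula X) : tup N X -> Prop :=
  match f with
  | FBot => fun _ => False
  | FEq s t1 t2 => fun a => eval a t1 = eval a t2
  | FRel r t => fun a => @rint L N r (fun v => eval a (t v))
  | FImp g h => fun a => sat g a -> sat h a
  | FAll s g => fun a => forall z : N s, sat g (tcat a (tone z))
  end.

End Semantics.

Arguments tnil {L} N.

(** * Theories *)

Definition theory (L : signature) := set (sentence L).

Definition models (L : signature) (N : structure L) (T : theory L) : Prop :=
  forall f, T f -> sat f (tnil N).

Definition entails (L : signature) (T : theory L) (f : sentence L) : Prop :=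
  forall N : structure L, models N T -> sat f (tnil N).

Definition complete_theory (L : signature) (T : theory L) : Prop :=
  (exists N : structure L, models N T) /\
  (forall f : sentence L, entails T f \/ entails T (FNot f)).

Definition has_IP (L : signature) (N : structure L) (X Y : ctx (lsort L))
    (f : formula (CCat X Y)) : Prop :=
  exists (a : nat -> tup N X) (b : set nat -> tup N Y),
    forall (i : nat) (S : set nat), sat f (tcat (a i) (b S)) <-> S i.

Definition dependent (L : signature) (T : theory L) : Prop :=
  forall N : structure L, models N T ->
  forall (X Y : ctx (lsort L)) (f : formula (CCat X Y)), ~ has_IP N f.

(** [T = T^eq], up to interdefinability: every 0-definable equivalence relation
    [E] on [X]-tuples has a sort [t] of [E]-classes, the quotient map being
    0-definable (by [F]), uniformly in the models of [T]. *)
Definition is_eq_theory (L : signature) (T : theory L) : Prop :=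
  forall (X : ctx (lsort L)) (E : formula (CCat X X)),
  (forall N : structure L, models N T ->
     Equivalence (fun a a' : tup N X => sat E (tcat a a'))) ->
  exists (t : lsort L) (F : formula (CCat X (COne t))),
  forall N : structure L, models N T ->
  [/\ forall a : tup N X, exists! z : N t, sat F (tcat a (tone z)),
      forall z : N t, exists a : tup N X, sat F (tcat a (tone z)) &
      forall (a a' : tup N X) (z : N t), sat F (tcat a (tone z)) ->
        (sat F (tcat a' (tone z)) <-> sat E (tcat a a'))].

(** * Parameters and types *)

Definition elt (L : signature) (N : structure L) := {s : lsort L & N s}.

Definition tuple_in (L : signature) (N : structure L) (X : ctx (lsort L))
    (A : set (elt N)) (a : tup N X) : Prop :=
  forall v : var X, A (existT (fun s => N s) (vsort v) (a v)).

(** A formula [f(x, c)], with [x] of shape [X], [f(x, y)] over the empty set and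
    [c] a finite tuple of parameters. *)
Record pformula (L : signature) (C : structure L) (X : ctx (lsort L)) := PF {
  pctx : ctx (lsort L);
  pform : formula (CCat X pctx);
  ppar : tup C pctx }.

Arguments pctx {L C X} p.
Arguments pform {L C X} p.
Arguments ppar {L C X} p.

Section Types.
Variables (L : signature) (C : structure L).
Implicit Types (X Y Z : ctx (lsort L)) (A : set (elt C)).

Definition psat X (a : tup C X) (psi : pformula C X) : Prop :=
  sat (pform psi) (tcat a (ppar psi)).

Definition pnot X (psi : pformula C X) : pformula C X :=
  PF (FNot (pform psi)) (ppar psi).

Definition over_set A X (psi : pformula C X) : Prop := tuple_in A (ppar psi).

(** [p] is an element of [S_X(A)]; global types are the case [A = setT]. *)
Record complete_type A X (p : set (pformula C X)) : Prop := CompleteType {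
  ct_over : forall psi, p psi -> over_set A psi;
  ct_consistent : forall S : set (pformula C X), finite_set S -> S `<=` p ->
    exists a : tup C X, forall psi, S psi -> psat a psi;
  ct_complete : forall psi, over_set A psi -> p psi \/ p (pnot psi) }.

Definition same_type A Y (b b' : tup C Y) : Prop :=
  forall psi : pformula C Y, over_set A psi -> (psat b psi <-> psat b' psi).

Definition k_inconsistent X Y (k : nat) (f : formula (CCat X Y))
    (b : nat -> tup C Y) : Prop :=
  forall h : 'I_k -> nat, injective h ->
  ~ exists a : tup C X, forall i, sat f (tcat a (b (h i))).

Definition divides A X (psi : pformula C X) : Prop :=
  exists (k : nat) (b : nat -> tup C (pctx psi)),
    (forall i, same_type A (b i) (ppar psi)) /\ k_inconsistent k (pform psi) b.

(** A set of formulas forks over [A] if a finite conjunction of its members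
    implies a finite disjunction of formulas each of which divides over [A]. *)
Definition forks A X (p : set (pformula C X)) : Prop :=
  exists S D : set (pformula C X),
  [/\ finite_set S, S `<=` p, finite_set D,
      forall psi, D psi -> divides A psi &
      forall a : tup C X, (forall psi, S psi -> psat a psi) ->
        exists2 psi, D psi & psat a psi].

(** In the second clause [f(x, y, d)] with [d] in [A] is the formula over [A]. *)
Definition heir A X (p q : set (pformula C X)) : Prop :=
  p `<=` q /\
  forall Y Z (f : formula (CCat X (CCat Y Z))) (d : tup C Z),
    tuple_in A d ->
    forall c : tup C Y, q (PF f (tcat c d)) ->
    exists2 m : tup C Y, tuple_in A m & p (PF f (tcat m d)).

End Types.

(** * Monster models *)

Definition card_lt (U V : Type) (A : set U) (B : set V) : Prop :=
  A #<= B /\ ~ (B #<= A).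

Definition automorphism (L : signature) (C : structure L)
    (g : forall s, C s -> C s) : Prop :=
  [/\ forall s, bijective (g s),
      forall (f : fsym L) (a : tup C (fdom f)),
        g (fcod f) (fint a) = fint (fun v => g (vsort v) (a v)) &
      forall (r : rsym L) (a : tup C (rdom r)),
        rint a <-> rint (fun v => g (vsort v) (a v))].

(** Only the values of [g] on [A] matter. *)
Definition partial_elementary (L : signature) (C : structure L)
    (A : set (elt C)) (g : forall s, C s -> C s) : Prop :=
  forall (X : ctx (lsort L)) (f : formula X) (a : tup C X), tuple_in A a ->
    (sat f a <-> sat f (fun v => g (vsort v) (a v) : C (vsort v))).

(** [C] is a kappa-saturated, strongly kappa-homogeneous model of [T], where
    kappa is the cardinality of [K] and kappa > |T| + aleph_0.  Sets of
    cardinality < kappa are the small ones. *)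
Record monster (L : signature) (T : theory L) (K : Type) (C : structure L) :
    Prop := Monster {
  monster_models : models C T;
  monster_large :
    card_lt [set: (nat + lsort L + fsym L + rsym L)%type] [set: K];
  monster_saturated : forall A : set (elt C), card_lt A [set: K] ->
    forall (X : ctx (lsort L)) (p : set (pformula C X)), complete_type A p ->
    exists a : tup C X, forall psi, p psi -> psat a psi;
  monster_homogeneous : forall A : set (elt C), card_lt A [set: K] ->
    forall g : (forall s, C s -> C s), partial_elementary A g ->
    exists2 h : (forall s, C s -> C s), automorphism h &
      forall (s : lsort L) (z : C s),
        A (existT (fun s => C s) s z) -> h s z = g s z }.

(** * Substructures *)

Record substructure (L : signature) (C : structure L) := Substructure {
  dom :> set (elt C);
  dom_inh : forall s, exists z : C s, dom (existT (fun s => C s) s z);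
  dom_closed : forall (f : fsym L) (a : tup C (fdom f)), tuple_in dom a ->
    dom (existT (fun s => C s) (fcod f) (fint a)) }.

Section Substructure.
Variables (L : signature) (C : structure L) (M : substructure C).

Definition sub_carrier (s : lsort L) : Type :=
  {z : C s | dom M (existT (fun s => C s) s z)}.

Lemma sub_carrier_inh s : inhabited (sub_carrier s).
Proof. by have [z Mz] := dom_inh M s; exists; exists z. Qed.

Definition sub_val X (a : assignment sub_carrier X) : tup C X :=
  fun v => proj1_sig (a v).

Definition sub_structure : structure L :=
  @Structure L sub_carrier sub_carrier_inh
    (fun f a => exist _ (fint (sub_val a))
                  (dom_closed (fun v => proj2_sig (a v))))
    (fun r a => rint (sub_val a)).

Definition elementary : Prop :=
  forall (X : ctx (lsort L)) (f : formula X) (a : tup sub_structure X),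
    sat f a <-> sat f (sub_val a).

End Substructure.

(* Main.v *)
Require Import Defs.
From mathcomp Require Import all_boot.
From mathcomp Require Import boolp classical_sets functions cardinality filter.

(** Everything takes place in [M], with ultrafilters on tuples of [M] in place of
    types over [M].  A global type that is invariant over [M] contains no formula
    dividing over [M], so by compactness an invariant heir of [p] is missing only
    if formulas [psi(x, c)] not represented in [p] and formulas
    [phi(x, b) xor phi(x, b')], with [b] and [b'] of the same type over [M], cover
    the sort of [x].  Let [e] be the tuple of all the parameters.  The formulas of
    the second kind are removable: every definable set containing [e] contains
    finitely many tuples of [M] such that no [x] satisfies, at each of them, one
    of the formulas of the second kind.  A covering thus induces a covering of
    [p] by finitely many [psi(x, m)] with [m] in [M], none of which belongs to
    [p].

    Removability is proved by adding the formulas one at a time.  Let [r] be an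
    ultrafilter extending the type of [b], and let [d] realize [r] generically over
    [e]; then [phi(x, b) xor phi(x, b')] implies [phi(x, b) xor phi(x, d)] or
    [phi(x, b') xor phi(x, d)].  The type of [(e, d)] extends to an ultrafilter [U]
    projecting to [r] along both [b] and [d].  In a Morley sequence of [U], any
    choice of one member in each pair [(b, d)] gives a Morley sequence of [r]; hence
    if [phi(x, b) xor phi(x, d)] held along arbitrarily long ones, [phi] would
    shatter arbitrarily large finite sets, against dependence. *)

Set Implicit Arguments.
Unset Strict Implicit.
Unset Printing Implicit Defensive.

Local Open Scope classical_set_scope.

(** * Substitution of terms into formulas *)

Section Substitution.
Variable L : signature.
Implicit Types X Y Z : ctx (lsort L).

Fixpoint tsubst X Z (sigma : forall v : var X, term Z (vsort v)) s
    (t : term X s) : term Z s :=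
  match t with
  | Var v => sigma v
  | App f u => App (fun w => tsubst sigma (u w))
  end.

Definition scat X Y Z (sigma : forall v : var X, term Z (vsort v))
    (tau : forall v : var Y, term Z (vsort v)) :
    forall v : var (CCat X Y), term Z (vsort v) :=
  fun v => match v with inl x => sigma x | inr y => tau y end.

Definition varl X Y (v : var X) : term (CCat X Y) (vsort v) :=
  @Var L (CCat X Y) (inl v).
Definition varr X Y (v : var Y) : term (CCat X Y) (vsort v) :=
  @Var L (CCat X Y) (inr v).
Arguments varl {X Y} v.
Arguments varr {X Y} v.

Definition lift_subst X Z (sigma : forall v : var X, term Z (vsort v)) s :
    forall v : var (CCat X (COne s)), term (CCat Z (COne s)) (vsort v) :=
  scat (fun x => tsubst varl (sigma x)) varr.

Fixpoint fsubst X (f : formula X) :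
    forall Z, (forall v : var X, term Z (vsort v)) -> formula Z :=
  match f with
  | FBot => fun Z sigma => FBot
  | FEq s t1 t2 => fun Z sigma => FEq (tsubst sigma t1) (tsubst sigma t2)
  | FRel r t => fun Z sigma => FRel (fun v => tsubst sigma (t v))
  | FImp g h => fun Z sigma => FImp (fsubst g sigma) (fsubst h sigma)
  | FAll s g => fun Z sigma => FAll (fsubst g (lift_subst sigma (s := s)))
  end.

Variable N : structure L.

Lemma eval_subst X Z (sigma : forall v : var X, term Z (vsort v)) s
    (t : term X s) (a : tup N Z) :
  eval a (tsubst sigma t) = eval (fun v => eval a (sigma v)) t.
Proof.
elim: t => //= f u IH; congr (fint _); apply: functional_extensionality_dep => v.
exact: IH.
Qed.

Lemma sat_subst X (f : formula X) Z (sigma : forall v : var X, term Z (vsort v))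
    (a : tup N Z) :
  sat (fsubst f sigma) a <-> sat f (fun v => eval a (sigma v)).
Proof.
elim: f Z sigma a => [{}X|{}X s t1 t2|{}X r t|{}X g IHg h IHh|{}X s g IH] Z sigma a //=.
- by rewrite !eval_subst.
- by under [fun v => _]functional_extensionality_dep => v do rewrite eval_subst.
- by rewrite IHg IHh.
- suff E z : (fun v => eval (tcat a (tone z)) (lift_subst sigma (s := s) v)) =
      tcat (fun v => eval a (sigma v)) (tone z).
    by split=> H z; have := H z; rewrite IH E.
  by apply: functional_extensionality_dep => -[x|u] //=; rewrite eval_subst.
Qed.

End Substitution.

Arguments varl {L X Y} v.
Arguments varr {L X Y} v.

Definition tfst (L : signature) (N : structure L) X Y (z : tup N (CCat X Y)) :
  tup N X := fun v => z (inl v).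
Definition tsnd (L : signature) (N : structure L) X Y (z : tup N (CCat X Y)) :
  tup N Y := fun v => z (inr v).

Section Tuples.
Variables (L : signature) (N : structure L).
Implicit Types X Y Z : ctx (lsort L).

Lemma tcat_eta X Y (z : tup N (CCat X Y)) : tcat (tfst z) (tsnd z) = z.
Proof. by apply: functional_extensionality_dep => -[]. Qed.

Lemma tnil_eta (z : tup N CNil) : z = tnil N.
Proof. by apply: functional_extensionality_dep => -[]. Qed.

Lemma tone_eta s (z : tup N (COne s)) : z = tone (z tt).
Proof. by apply: functional_extensionality_dep => -[]. Qed.

Lemma tup_inh X : inhabited (tup N X).
Proof.
elim: X => [|s|X [a] Y [b]]; first by exists; exact: tnil.
  by have [z] := carrier_inh N s; exists; exact: tone.
by exists; exact: tcat.
Qed.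

End Tuples.

(** * Sets defined by one formula in two structures *)

Section Codefinable.
Variables (L : signature) (N C : structure L) (iota : forall s, N s -> C s).
Implicit Types X Y Z : ctx (lsort L).

Definition timage X (a : tup N X) : tup C X := fun v => iota (a v).

(** Carrying both sets together lets the closure properties be proved once for two uses: [iota] the
    identity of [N] gives definability in [N], and [iota] the inclusion of [M] in [C] gives transfer
    between them. *)
Definition codefinable X (A : set (tup N X)) (A' : set (tup C X)) : Prop :=
  exists Y (f : formula (CCat X Y)) (d : tup N Y),
    (forall a, A a <-> sat f (tcat a d)) /\
    (forall a, A' a <-> sat f (tcat a (timage d))).

Definition reindexing Z X (m : tup N Z -> tup N X) (m' : tup C Z -> tup C X) :=
  exists sigma : forall v : var X, term Z (vsort v),
    (forall z, m z = fun v => eval z (sigma v)) /\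
    (forall z, m' z = fun v => eval z (sigma v)).

Lemma reindexing_id X : reindexing (fun x : tup N X => x) (fun x => x).
Proof. by exists (fun v => Var v). Qed.

Lemma reindexing_tfst X Y Z (m : tup N Z -> tup N (CCat X Y)) m' :
  reindexing m m' -> reindexing (fun z => tfst (m z)) (fun z => tfst (m' z)).
Proof.
by move=> [sigma [H H']]; exists (fun v => sigma (inl v)); split=> z;
  rewrite ?H ?H'.
Qed.

Lemma reindexing_tsnd X Y Z (m : tup N Z -> tup N (CCat X Y)) m' :
  reindexing m m' -> reindexing (fun z => tsnd (m z)) (fun z => tsnd (m' z)).
Proof.
by move=> [sigma [H H']]; exists (fun v => sigma (inr v)); split=> z;
  rewrite ?H ?H'.
Qed.

Lemma reindexing_tcat X Y Z (m : tup N Z -> tup N X) m' (n : tup N Z -> tup N Y) n' :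
  reindexing m m' -> reindexing n n' ->
  reindexing (fun z => tcat (m z) (n z)) (fun z => tcat (m' z) (n' z)).
Proof.
move=> [s [H H']] [t [K K']].
exists (scat s t).
by split=> z; apply: functional_extensionality_dep => -[v|v];
  rewrite /= ?H ?K ?H' ?K'.
Qed.

Lemma codefinable_comp X Z (A : set (tup N X)) A' (m : tup N Z -> tup N X) m' :
  codefinable A A' -> reindexing m m' ->
  codefinable (fun z => A (m z)) (fun z => A' (m' z)).
Proof.
move=> [Y [f [d [H H']]]] [s [K K']].
pose t := scat (fun x => tsubst varl (s x)) (varr (X := Z) (Y := Y)).
exists Y, (fsubst f t), d; split=> z; rewrite sat_subst ?H ?H' ?K ?K'.
- suff -> : (fun v => eval (tcat z d) (t v)) = tcat (fun v => eval z (s v)) d by [].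
  by apply: functional_extensionality_dep => -[v|v] //=; rewrite eval_subst.
- suff -> : (fun v => eval (tcat z (timage d)) (t v)) =
    tcat (fun v => eval z (s v)) (timage d) by [].
  by apply: functional_extensionality_dep => -[v|v] //=; rewrite eval_subst.
Qed.

Lemma codefinable_comp2 X Y Z (R : tup N X -> tup N Y -> Prop) R'
    (m : tup N Z -> tup N X) m' (n : tup N Z -> tup N Y) n' :
  codefinable (fun z : tup N (CCat X Y) => R (tfst z) (tsnd z))
    (fun z => R' (tfst z) (tsnd z)) ->
  reindexing m m' -> reindexing n n' ->
  codefinable (fun z => R (m z) (n z)) (fun z => R' (m' z) (n' z)).
Proof. by move=> H Hm Hn; exact: codefinable_comp H (reindexing_tcat Hm Hn). Qed.

Lemma codefinable_iff X (A B : set (tup N X)) A' B' :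
  codefinable A A' -> (forall a, A a <-> B a) -> (forall a, A' a <-> B' a) ->
  codefinable B B'.
Proof.
move=> [Y [f [d [H H']]]] AB AB'; exists Y, f, d.
by split=> a; rewrite -?AB -?AB' ?H ?H'.
Qed.

Lemma codefinable_sat X Y (f : formula (CCat X Y)) :
  codefinable (fun z : tup N (CCat X Y) => sat f z) (fun z => sat f z).
Proof.
exists CNil, (fsubst f varl), (tnil N).
by split=> z; rewrite sat_subst.
Qed.

Lemma codefinable_section X Y (A : set (tup N (CCat X Y))) A' (d : tup N Y) :
  codefinable A A' ->
  codefinable (fun x => A (tcat x d)) (fun x => A' (tcat x (timage d))).
Proof.
move=> [W [f [e [H H']]]].
pose t := scat (scat varl (fun y : var Y => tsubst varr (varl (Y := W) y)))
  (fun w : var W => tsubst (varr (X := X)) (varr (X := Y) w)).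
exists (CCat Y W), (fsubst f t), (tcat d e).
split=> x; rewrite sat_subst ?H ?H'.
- suff -> : (fun v => eval (tcat x (tcat d e)) (t v)) = tcat (tcat x d) e by [].
  by apply: functional_extensionality_dep => -[[]|].
- suff -> : (fun v => eval (tcat x (timage (tcat d e))) (t v)) =
    tcat (tcat x (timage d)) (timage e) by [].
  by apply: functional_extensionality_dep => -[[]|].
Qed.

Lemma codefinable_imp X (A B : set (tup N X)) A' B' :
  codefinable A A' -> codefinable B B' ->
  codefinable (fun x => A x -> B x) (fun x => A' x -> B' x).
Proof.
move=> [Y [f [d [H H']]]] [Z [g [e [K K']]]].
(* The two parameter tuples are first treated as variables, then fixed together as the single tuple
   [tcat d e]. *)
have F : codefinable (fun z : tup N (CCat X (CCat Y Z)) =>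
    sat f (tcat (tfst z) (tfst (tsnd z))) -> sat g (tcat (tfst z) (tsnd (tsnd z))))
  (fun z =>
    sat f (tcat (tfst z) (tfst (tsnd z))) -> sat g (tcat (tfst z) (tsnd (tsnd z)))).
  pose s := scat varl (fun y : var Y => tsubst (varr (X := X)) (varl (Y := Z) y)).
  pose t := scat varl (fun y : var Z => tsubst (varr (X := X)) (varr (X := Y) y)).
  apply: codefinable_iff (codefinable_sat (FImp (fsubst f s) (fsubst g t))) _ _ => z /=;
  rewrite !sat_subst;
  (have -> : (fun v => eval z (s v)) = tcat (tfst z) (tfst (tsnd z))
    by apply: functional_extensionality_dep => -[]);
  by have -> : (fun v => eval z (t v)) = tcat (tfst z) (tsnd (tsnd z))
    by apply: functional_extensionality_dep => -[].
apply: codefinable_iff (codefinable_section (tcat d e) F) _ _ => x.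
  by rewrite H K.
by rewrite H' K'.
Qed.

Lemma codefinable_false X :
  codefinable (fun _ : tup N X => False) (fun _ => False).
Proof. by exists CNil, FBot, (tnil N). Qed.

Lemma codefinable_all1 X s (A : set (tup N (CCat X (COne s)))) A' :
  codefinable A A' ->
  codefinable (fun x => forall z, A (tcat x (tone z)))
    (fun x => forall z, A' (tcat x (tone z))).
Proof.
move=> [Y [f [d [H H']]]].
pose t := scat (scat (fun x : var X => tsubst varl (varl (Y := Y) x)) varr)
  (fun y : var Y => tsubst (varl (Y := COne s)) (varr (X := X) y)).
exists Y, (FAll (fsubst f t)), d.
have E (K : structure L) (x : tup K X) (e : tup K Y) z :
    (fun v => eval (tcat (tcat x e) (tone z)) (t v)) = tcat (tcat x (tone z)) e.
  by apply: functional_extensionality_dep => -[[]|].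
split=> x /=; split=> Q z; have := Q z.
- by rewrite sat_subst E H.
- by rewrite sat_subst E H.
- by rewrite sat_subst E H'.
- by rewrite sat_subst E H'.
Qed.

Lemma codefinable_all X Y (A : set (tup N (CCat X Y))) A' :
  codefinable A A' ->
  codefinable (fun x => forall y, A (tcat x y)) (fun x => forall y, A' (tcat x y)).
Proof.
elim: Y X A A' => [|s|Y1 IH1 Y2 IH2] X A A' H.
- apply: codefinable_iff (codefinable_section (tnil N) H) _ _ => x.
    by split=> [Q y|]; [rewrite (tnil_eta y) | apply].
  by rewrite (tnil_eta (timage _)); split=> [Q y|]; [rewrite (tnil_eta y) | apply].
- apply: codefinable_iff (codefinable_all1 H) _ _ => x;
  by split=> Q y; [rewrite (tone_eta y) | ]; apply: Q.
(* Quantifying over a concatenation amounts to quantifying twice, once the tuple is reassociated. *)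
- have K : codefinable
      (fun z : tup N (CCat (CCat X Y1) Y2) =>
         A (tcat (tfst (tfst z)) (tcat (tsnd (tfst z)) (tsnd z))))
      (fun z => A' (tcat (tfst (tfst z)) (tcat (tsnd (tfst z)) (tsnd z)))).
    have H1 := reindexing_id (CCat (CCat X Y1) Y2).
    apply: codefinable_comp H _; apply: reindexing_tcat.
      exact: reindexing_tfst (reindexing_tfst H1).
    exact: reindexing_tcat (reindexing_tsnd (reindexing_tfst H1)) (reindexing_tsnd H1).
  apply: codefinable_iff (IH1 _ _ _ (IH2 _ _ _ K)) _ _ => x;
  (split=> Q y; [rewrite -(tcat_eta y); exact: Q | move=> z; exact: Q]).
Qed.

Lemma codefinable_eq Z Y (m n : tup N Z -> tup N Y) m' n' :
  reindexing m m' -> reindexing n n' ->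
  codefinable (fun z => m z = n z) (fun z => m' z = n' z).
Proof.
elim: Y m n m' n' => [|s|Y1 IH1 Y2 IH2] m n m' n' Hm Hn.
- apply: codefinable_iff (codefinable_imp (codefinable_false Z) (codefinable_false Z)) _ _.
    by move=> z; rewrite (tnil_eta (m z)) (tnil_eta (n z)).
  by move=> z; rewrite (tnil_eta (m' z)) (tnil_eta (n' z)).
- have [u [Em Em']] := Hm; have [w [En En']] := Hn.
  pose f : formula (CCat Z CNil) :=
    FEq (tsubst varl (u tt))
        (tsubst varl (w tt)).
  exists CNil, f, (tnil N); split=> z; rewrite /f /= !eval_subst.
    rewrite (tone_eta (m z)) (tone_eta (n z)) Em En.
    by split=> [E|E]; [exact: (f_equal (fun h : tup N (COne s) => h tt) E) |
    rewrite /= in E; rewrite E].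
  rewrite (tone_eta (m' z)) (tone_eta (n' z)) Em' En'.
  by split=> [E|E]; [exact: (f_equal (fun h : tup C (COne s) => h tt) E) |
    rewrite /= in E; rewrite E].
- have H1 := IH1 _ _ _ _ (reindexing_tfst Hm) (reindexing_tfst Hn).
  have H2 := IH2 _ _ _ _ (reindexing_tsnd Hm) (reindexing_tsnd Hn).
  have F := codefinable_false Z.
  (* The conjunction of the two equalities is expressed by implication and falsity. *)
  apply: codefinable_iff (codefinable_imp (codefinable_imp H1
    (codefinable_imp H2 F)) F) _ _ => z.
    split=> [/not_implyP[E1 /contrapT E2]|-> H]; last exact: H.
    by rewrite -(tcat_eta (m z)) E1 E2 tcat_eta.
  split=> [/not_implyP[E1 /contrapT E2]|-> H]; last exact: H.
  by rewrite -(tcat_eta (m' z)) E1 E2 tcat_eta.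
Qed.

Lemma codefinable_not X (A : set (tup N X)) A' :
  codefinable A A' -> codefinable (fun x => ~ A x) (fun x => ~ A' x).
Proof. by move=> H; exact: codefinable_imp H (codefinable_false X). Qed.

Lemma codefinable_true X : codefinable (fun _ : tup N X => True) (fun _ => True).
Proof.
by apply: codefinable_iff (codefinable_not (codefinable_false X)) _ _ => z; split=> // _ [].
Qed.

Lemma codefinable_or X (A B : set (tup N X)) A' B' :
  codefinable A A' -> codefinable B B' ->
  codefinable (fun x => A x \/ B x) (fun x => A' x \/ B' x).
Proof.
move=> H K; apply: codefinable_iff (codefinable_imp (codefinable_not H) K) _ _ => x.
  by split=> [Q|[]//]; have [|/Q] := pselect (A x); [left|right].
by split=> [Q|[]//]; have [|/Q] := pselect (A' x); [left|right].
Qed.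

Lemma codefinable_and X (A B : set (tup N X)) A' B' :
  codefinable A A' -> codefinable B B' ->
  codefinable (fun x => A x /\ B x) (fun x => A' x /\ B' x).
Proof.
move=> H K.
apply: codefinable_iff (codefinable_not (codefinable_imp H (codefinable_not K))) _ _ => x.
  by split=> [/not_implyP[? /contrapT]|[? ?] H1]; tauto.
by split=> [/not_implyP[? /contrapT]|[? ?] H1]; tauto.
Qed.

Lemma codefinable_ex X Y (A : set (tup N (CCat X Y))) A' :
  codefinable A A' ->
  codefinable (fun x => exists y, A (tcat x y)) (fun x => exists y, A' (tcat x y)).
Proof.
move=> H.
apply: codefinable_iff (codefinable_not (codefinable_all (codefinable_not H))) _ _ => x.
  by split=> [/existsNP[y /contrapT]|[y Ay] /(_ y)//]; exists y.
by split=> [/existsNP[y /contrapT]|[y Ay] /(_ y)//]; exists y.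
Qed.

End Codefinable.

Ltac reindex := repeat first [apply reindexing_id | apply reindexing_tcat |
  apply reindexing_tfst | apply reindexing_tsnd].

(** * Elementary facts about ultrafilters *)

Section Ultrafilters.
Variables (T : Type) (F : set_system T).

Lemma ultra_intro : ProperFilter F -> (forall A, F A \/ F (~` A)) -> UltraFilter F.
Proof.
move=> FP FC; split=> // G GP FG; rewrite eqEsubset; split=> // A GA.
have [//|/FG GnA] := FC A.
by have := filter_not_empty G; rewrite -(setICr A); case; exact: filterI.
Qed.

Lemma ultraC (A : set T) : UltraFilter F -> ~ F A -> F (~` A).
Proof. by move=> FU nFA; have [] := in_ultra_setVsetC A FU. Qed.

Lemma ultraCN (A : set T) : ProperFilter F -> F (~` A) -> ~ F A.
Proof.
by move=> FP FnA FA; apply: (filter_not_empty F); rewrite -(setICr A); exact: filterI.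
Qed.

Lemma ultra_or (A B : set T) : UltraFilter F -> F (A `|` B) -> F A \/ F B.
Proof.
move=> FU FAB; have [FA|nFA] := pselect (F A); [by left|right].
by apply: filterS (filterI FAB (ultraC FU nFA)) => x [[]].
Qed.

End Ultrafilters.

Lemma ultra_fmap T V (m : T -> V) (F : set_system T) :
  UltraFilter F -> UltraFilter (fmap m F).
Proof.
by move=> FU; apply: ultra_intro => A; exact: (in_ultra_setVsetC (m @^-1` A) FU).
Qed.

(** * Combinatorics of finite coverings *)

Section Coverings.
Variables P E : Type.
Implicit Types (D : set E) (R S : P -> E -> Prop) (U : set_system E).

(** It is the complements of the [R]-fibres of elements of [D] that cover [W]. *)
Fixpoint coverable D R n (W : set P) : Prop :=
  match n with
  | 0 => forall x, ~ W x
  | n.+1 => exists2 e, D e & coverable D R n (fun x => W x /\ R x e)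
  end.

(** As [coverable], for the elements of a Morley sequence of [U], listed from the
    last one to the first one. *)
Fixpoint exhausts U R n (W : set P) : Prop :=
  match n with
  | 0 => forall x, ~ W x
  | n.+1 => U (fun e => exhausts U R n (fun x => W x /\ R x e))
  end.

Lemma coverable_sub D D' R R' n (W W' : set P) :
  D `<=` D' -> (forall x e, R' x e -> R x e) -> W' `<=` W ->
  coverable D R n W -> coverable D' R' n W'.
Proof.
move=> DD' RR'; elim: n W W' => [|n IH] W W' WW' /=; first by move=> H x /WW'/H.
move=> [e De H]; exists e; first exact: DD'.
by apply: IH H => x [/WW' Wx /RR' Rx].
Qed.

Lemma coverable_union D R m n (W V : set P) :
  coverable D R m W -> coverable D R n V -> coverable D R (m + n) (W `|` V).
Proof.
elim: m W V => [|m IH] W V /=.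
  by move=> W0; apply: coverable_sub => // x [/W0|].
move=> [e De HW HV]; exists e => //.
have HV' : coverable D R n (fun x => V x /\ R x e).
  by apply: coverable_sub HV => // x [].
by apply: coverable_sub (IH _ _ HW HV') => // x [[Wx|Vx] Rx]; [left|right].
Qed.

(** Once [e] has been used, the points left satisfy [R x e] or [S x e]. The former are treated by
    induction, the latter by the [m] elements provided for [e], so each of the [n] elements costs
    [m.+1]. *)
Lemma coverable_refine D D1 R S m n (W : set P) :
  (forall e, D1 e -> D e /\
     coverable D (fun x e => R x e \/ S x e) m (fun x => W x /\ S x e)) ->
  forall V : set P, coverable D1 R n V -> V `<=` W ->
  coverable D (fun x e => R x e \/ S x e) (n * m.+1) V.
Proof.
move=> D1D; elim: n => [|n IH] V //= [e /D1D[De He] HV VW].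
exists e => //.
have HV' := IH _ HV (fun x (H : V x /\ R x e) => VW x H.1).
by apply: coverable_sub (coverable_union He HV') => // x [Vx [Rx|Sx]];
  [right | left; split=> //; exact: VW].
Qed.

End Coverings.

(** * Alternation along Morley sequences, and shattering *)

Section Alternation.
Variables (P Y : Type) (phi : P -> Y -> Prop).

Definition signed (b : bool) x y := if b then phi x y else ~ phi x y.

(** Some point of [W] has sign pattern [s] along a Morley sequence of [r]; iterating [r] as a
    quantifier takes the place of realizing the sequence. *)
Fixpoint realizable (r : set_system Y) (s : seq bool) (W : set P) : Prop :=
  match s with
  | [::] => exists x, W x
  | b :: s => r (fun y => realizable r s (fun x => W x /\ signed b x y))
  end.

Definition shatters_arbitrarily_many :=
  forall k, exists y : nat -> Y, forall S : nat -> bool,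
  exists x, forall j, (j < k)%N -> (phi x (y j) <-> S j).

Variable r : set_system Y.
Hypothesis r_ultra : UltraFilter r.

Lemma realizable_sub s (W V : set P) :
  W `<=` V -> realizable r s W -> realizable r s V.
Proof.
elim: s W V => [|b s IH] W V WV /=; first by move=> [x /WV]; exists x.
by apply: filterS => y; apply: IH => x [/WV].
Qed.

Lemma realizable_union s (W V : set P) :
  realizable r s (W `|` V) -> realizable r s W \/ realizable r s V.
Proof.
elim: s W V => [|b s IH] W V /=.
  by move=> [x [Wx|Vx]]; [left|right]; exists x.
move=> H; apply: ultra_or; apply: filterS H => y H; apply: IH.
by apply: realizable_sub H => x [[Wx|Vx] Sx]; [left|right].
Qed.

(** A single [y] must serve all patterns at once. There are finitely many, so a common [y] exists in
    [r]; it splits each [W i] in two by the sign of [phi], which is why the induction needs a finite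
    family. *)
Lemma realizable_shatters k (I : finType) (W : I -> set P) (y0 : Y) :
  (forall i s, size s = k -> realizable r s (W i)) ->
  exists y : nat -> Y, forall i (S : nat -> bool),
  exists2 x, W i x & forall j, (j < k)%N -> (phi x (y j) <-> S j).
Proof.
elim: k I W => [|k IH] I W H.
  exists (fun=> y0) => i S; have [x Wx] := H i [::] erefl; by exists x.
have : r (fun y => forall t : I * bool * k.-tuple bool,
    realizable r t.2 (fun x => W t.1.1 x /\ signed t.1.2 x y)).
  by apply: filter_forall => -[[i b] t]; apply: (H i (b :: t)); rewrite /= size_tuple.
move=> /filter_ex[y Hy].
have [|z Hz] := IH (I * bool)%type (fun t x => W t.1 x /\ signed t.2 x y).
  by move=> t s /eqP sk; exact: (Hy (t, Tuple sk)).
exists (fun j => if j is j'.+1 then z j' else y) => i S.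
have [x [/= Wx Sx] Hx] := Hz (i, S 0%N) (fun j => S j.+1).
exists x => // -[|j] jk; last exact: Hx.
by move: Sx; rewrite /signed; case: (S 0%N) => ?; split.
Qed.

(** In an [r]-Morley sequence of pairs either member of each pair may be chosen,
    and every choice is a Morley sequence of [r]. *)
Lemma alternation_exhausts (E : Type) (U : set_system E) (beta beta' : E -> Y) :
  UltraFilter U -> inhabited Y ->
  (forall B, r B -> U (beta @^-1` B)) -> (forall B, r B -> U (beta' @^-1` B)) ->
  ~ shatters_arbitrarily_many ->
  exists k, exhausts U (fun x e => ~ (phi x (beta e) <-> phi x (beta' e))) k setT.
Proof.
pose R x e := ~ (phi x (beta e) <-> phi x (beta' e)).
move=> U_ultra [y0] rU rU' notsh; apply: contrapT => /forallNP noexh.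
(* As [r] is an ultrafilter, the image of [U] under such a map [b] is contained in [r] as well as
   containing it. *)
have Ur (b : E -> Y) B : (forall B, r B -> U (b @^-1` B)) -> U (b @^-1` B) -> r B.
  move=> rUb UB; apply: contrapT => /(ultraC r_ultra)/rUb K.
  exact: (ultraCN _ K UB).
have main s (W : set P) : ~ exhausts U R (size s) W -> realizable r s W.
  elim: s W => [|b s IH] W /=.
    by move=> /existsNP[x /contrapT Wx]; exists x.
  move=> /(ultraC U_ultra) H.
  suff : U ((fun e => realizable r s (fun x => W x /\ signed b x (beta e))) `|`
            (fun e => realizable r s (fun x => W x /\ signed b x (beta' e)))).
    by move=> /(ultra_or U_ultra)[|] K; apply: Ur K.
  apply: filterS H => e /= /IH H; apply: realizable_union.
  apply: realizable_sub H => x [Wx Rx].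
  (* Where [phi] differs at the two members of the pair, one of them carries the sign [b]. *)
  suff [|] : signed b x (beta e) \/ signed b x (beta' e) by [left | right].
  rewrite /signed; move: Rx; rewrite /R; have [p|np] := pselect (phi x (beta e));
    by have [p'|np'] := pselect (phi x (beta' e)); case: (b); tauto.
apply: notsh => k.
have [|y Hy] := @realizable_shatters k unit (fun=> setT) y0.
  by move=> _ s sk; apply: main; rewrite sk; exact: noexh.
by exists y => S; have [x _] := Hy tt S; exists x.
Qed.

End Alternation.

(** * Definability and removability in a fixed structure *)

Section Removable.
Variables (L : signature) (N : structure L).
Implicit Types X Y Z E : ctx (lsort L).

Definition definable X (A : set (tup N X)) : Prop :=
  codefinable (fun s z => z) A A.

Definition definable_rel X Y (R : tup N X -> tup N Y -> Prop) : Prop :=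
  definable (fun z : tup N (CCat X Y) => R (tfst z) (tsnd z)).

Local Notation reindex_map m := (reindexing m m).

Lemma definable_comp2 X Y Z (R : tup N X -> tup N Y -> Prop)
    (m : tup N Z -> tup N X) (n : tup N Z -> tup N Y) :
  definable_rel R -> reindex_map m -> reindex_map n ->
  definable (fun z => R (m z) (n z)).
Proof. exact: codefinable_comp2. Qed.

Lemma definable_fibre X Y (R : tup N X -> tup N Y -> Prop) (h : tup N X) :
  definable_rel R -> definable (R h).
Proof.
move=> HR.
have H : definable (fun z : tup N (CCat Y X) => R (tsnd z) (tfst z)).
  by apply: definable_comp2 HR _ _; reindex.
exact: (codefinable_section h H).
Qed.

Lemma definable_image E Y (m : tup N E -> tup N Y) (A : set (tup N E)) :
  reindex_map m -> definable A -> definable (fun y => exists e, m e = y /\ A e).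
Proof.
move=> [s [Hm _]] HA.
suff H : definable (fun z : tup N (CCat Y E) => m (tsnd z) = tfst z /\ A (tsnd z)).
  exact: (codefinable_ex H).
apply: codefinable_and; last by apply: codefinable_comp HA _; reindex.
apply: codefinable_eq; last by reindex.
by exists (fun v => tsubst varr (s v)); split=> z; rewrite Hm;
  apply: functional_extensionality_dep => v; rewrite eval_subst.
Qed.

(** For fixed [n], coverability is a block of existential quantifiers over elements of [D h]
    followed by a universal one over [x], hence a first-order condition on [h]. *)
Lemma coverable_definable X E Z (D : tup N Z -> tup N E -> Prop)
    (R : tup N X -> tup N E -> Prop) (W : tup N Z -> tup N X -> Prop) n :
  definable_rel D -> definable_rel R -> definable_rel W ->
  definable (fun h => coverable (D h) R n (W h)).
Proof.
move=> HD HR; elim: n Z D W HD => [|n IH] Z D W HD HW /=.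
  exact: (codefinable_all (codefinable_not HW)).
have H : definable (fun w : tup N (CCat Z E) =>
    D (tfst w) (tsnd w) /\
    coverable (D (tfst w)) R n (fun x => W (tfst w) x /\ R x (tsnd w))).
  apply: codefinable_and => //.
  apply: (IH _ (fun w => D (tfst w)) (fun w x => W (tfst w) x /\ R x (tsnd w))).
    by apply: definable_comp2 HD _ _; reindex.
  by apply: codefinable_and; [apply: definable_comp2 HW _ _|apply: definable_comp2 HR _ _];
    reindex.
apply: codefinable_iff (codefinable_ex H) _ _ => h;
by split=> -[e]; [case=> De He; exists e | move=> De He; exists e].
Qed.

Variable X : ctx (lsort L).

(** The uniformity of [n] in the parameter [h] plays the role of saturation. *)
Definition removable E (U : set_system (tup N E)) (R : tup N X -> tup N E -> Prop) :=
  forall Z (D : tup N Z -> tup N E -> Prop), definable_rel D ->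
  exists n, forall h, U (D h) -> coverable (D h) R n setT.

Lemma removable_sub E (U : set_system (tup N E)) (R S : tup N X -> tup N E -> Prop) :
  (forall x e, S x e -> R x e) -> removable U R -> removable U S.
Proof.
move=> SR HR Z D HD; have [n Hn] := HR _ _ HD.
by exists n => h /Hn; exact: coverable_sub.
Qed.

Lemma removable_false E (U : set_system (tup N E)) :
  ProperFilter U -> removable U (fun _ _ => False).
Proof.
move=> UP Z D _; exists 1%N => h /filter_ex[e De].
by exists e => // x [].
Qed.

(** Removability tests [U] only on the definable sets [D h], so it depends only on the type that [U]
    refines. *)
Lemma removable_agree E (U V : set_system (tup N E)) (R : tup N X -> tup N E -> Prop) :
  UltraFilter U -> UltraFilter V -> (forall A, definable A -> U A -> V A) ->
  removable U R -> removable V R.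
Proof.
move=> UU VU UV HR Z D HD; have [n Hn] := HR _ _ HD.
exists n => h VD; apply: Hn; apply: contrapT => /(ultraC UU)/UV VnD.
have : V (~` D h) by apply: VnD; apply: codefinable_not; exact: definable_fibre.
by move=> /ultraCN; apply.
Qed.

(** Induction on the length of the Morley sequence exhausting [W]. For almost every [e] the part of
    [W] inside the [S]-fibre of [e] is coverable by the induction hypothesis. Such [e] form a
    definable set in [U]; removability of [R] applies to it, and [coverable_refine] combines the
    coverings. *)
Lemma removable_or E (U : set_system (tup N E)) (R S : tup N X -> tup N E -> Prop) k :
  UltraFilter U -> definable_rel R -> definable_rel S ->
  removable U R -> exhausts U S k setT ->
  removable U (fun x e => R x e \/ S x e).
Proof.
move=> UU dR dS HR HS.
suff main l Z (D : tup N Z -> tup N E -> Prop) (W : tup N Z -> tup N X -> Prop) :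
    definable_rel D -> definable_rel W ->
    exists n, forall h, U (D h) -> exhausts U S l (W h) ->
    coverable (D h) (fun x e => R x e \/ S x e) n (W h).
  move=> Z D HD; have [||n Hn] := main k _ D (fun _ _ => True) => //.
    exact: codefinable_true.
  by exists n => h UD; exact: Hn.
elim: l Z D W => [|l IH] Z D W HD HW; first by exists 0%N.
(* Here [e] joins the parameters, so that the bound [n1] is the same for all [e]. *)
have HW' : definable_rel (fun (w : tup N (CCat Z E)) x => W (tfst w) x /\ S x (tsnd w)).
  by apply: codefinable_and; [apply: definable_comp2 HW _ _|apply: definable_comp2 dS _ _];
    reindex.
have HD' : definable_rel (fun (w : tup N (CCat Z E)) e => D (tfst w) e).
  by apply: definable_comp2 HD _ _; reindex.
have [n1 Hn1] := IH _ _ _ HD' HW'.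
pose D1 h e := D h e /\
  coverable (D h) (fun x e => R x e \/ S x e) n1 (fun x => W h x /\ S x e).
have HD1 : definable_rel D1.
  apply: codefinable_and => //.
  by apply: coverable_definable HD' _ HW'; exact: codefinable_or.
have [n2 Hn2] := HR _ _ HD1.
exists (n2 * n1.+1)%N => h UD /= exh.
have UD1 : U (D1 h).
  by apply: filterS (filterI UD exh) => e [De exhe]; split=> //; exact: (Hn1 (tcat h e)).
apply: (coverable_refine (D1 := D1 h) (W := W h)) => //.
by exact: (coverable_sub _ _ _ (Hn2 _ UD1)).
Qed.

(** A definable set in [V] projects to a definable set in [U]; a covering found there lifts by
    choosing a second coordinate for each member. *)
Lemma removable_lift E Y (U : set_system (tup N E)) (V : set_system (tup N (CCat E Y)))
    (R : tup N X -> tup N E -> Prop) :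
  Filter V -> (forall A, definable A -> V (fun w => A (tfst w)) -> U A) ->
  removable U R -> removable V (fun x w => R x (tfst w)).
Proof.
move=> VF VU HR Z D HD.
have HD1 : definable_rel (fun h e => exists y, D h (tcat e y)).
  suff H : definable (fun z : tup N (CCat (CCat Z E) Y) =>
      D (tfst (tfst z)) (tcat (tsnd (tfst z)) (tsnd z))).
    exact: (codefinable_ex H).
  by apply: definable_comp2 HD _ _; reindex.
have [n Hn] := HR _ _ HD1; exists n => h VD.
have : U (fun e => exists y, D h (tcat e y)).
  apply: VU; first exact: (definable_fibre h HD1).
  by apply: filterS VD => w Dw; exists (tsnd w); rewrite tcat_eta.
move=> /Hn; elim: n {Hn} setT => [|n IH] W //= [e [y De] He].
by exists (tcat e y) => //; exact: IH.
Qed.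

Lemma removable_drop E Y (U : set_system (tup N E)) (V : set_system (tup N (CCat E Y)))
    (R : tup N X -> tup N E -> Prop) :
  (forall A, definable A -> U A -> V (fun w => A (tfst w))) ->
  removable V (fun x w => R x (tfst w)) -> removable U R.
Proof.
move=> UV HR Z D HD.
have HD1 : definable_rel (fun h (w : tup N (CCat E Y)) => D h (tfst w)).
  by apply: definable_comp2 HD _ _; reindex.
have [n Hn] := HR _ _ HD1; exists n => h UD.
have := Hn h (UV _ (definable_fibre h HD) UD).
elim: n {Hn} setT => [|n IH] W //= [w Dw Hw].
by exists (tfst w) => //; exact: IH.
Qed.

(** The hypothesis is the finite intersection property of the required sets. Only the definable sets
    of [V] are kept: all of [V] would already determine the images under [m] and [m']. *)
Lemma ultra_amalgam E Y (V : set_system (tup N E)) (r : set_system (tup N Y))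
    (m m' : tup N E -> tup N Y) :
  UltraFilter V -> UltraFilter r ->
  (forall A B, definable A -> V A -> r B -> exists e, [/\ A e, B (m e) & B (m' e)]) ->
  exists U, [/\ UltraFilter U, forall A, definable A -> V A -> U A,
    forall B, r B -> U (m @^-1` B) & forall B, r B -> U (m' @^-1` B)].
Proof.
move=> VU rU H.
pose G : set_system (tup N E) := fun S => exists A B,
  [/\ definable A, V A, r B & forall e, A e -> B (m e) -> B (m' e) -> S e].
have dT : definable (fun _ : tup N E => True) by exact: codefinable_true.
have VT : V (fun _ => True) by apply: filterS (@filterT _ V _).
have GP : ProperFilter G.
  split.
    by move=> [A [B [dA VA rB AB]]]; have [e [Ae Be Be']] := H _ _ dA VA rB; exact: (AB e).
  split.
  - by exists (fun=> True), setT; split=> //; exact: filterT.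
  - move=> S S' [A [B [dA VA rB AB]]] [A' [B' [dA' VA' rB' AB']]].
    exists (fun e => A e /\ A' e), (B `&` B'); split.
    + exact: codefinable_and.
    + exact: filterI.
    + exact: filterI.
    + by move=> e [Ae A'e] [Be B'e] [Be' B'e']; split; [exact: AB|exact: AB'].
  - move=> S S' SS' [A [B [dA VA rB AB]]]; exists A, B; split=> // e Ae Be Be'.
    by apply: SS'; exact: AB.
have [U [UU GU]] := ultraFilterLemma GP.
exists U; split=> // [A dA VA|B rB|B rB]; apply: GU.
- by exists A, setT; split=> //; exact: filterT.
- by exists (fun=> True), B.
- by exists (fun=> True), B.
Qed.

(** The outer quantifier belongs to the coordinate realized last: [e] realizes [U], then [d]
    realizes the average of [r] over [e]. *)
Definition ultra_prod E Y (U : set_system (tup N E)) (r : set_system (tup N Y)) :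
    set_system (tup N (CCat E Y)) :=
  fun A => r (fun d => U (fun e => A (tcat e d))).

Lemma ultra_prodP E Y (U : set_system (tup N E)) (r : set_system (tup N Y)) :
  UltraFilter U -> UltraFilter r -> UltraFilter (ultra_prod U r).
Proof.
move=> UU rU; apply: ultra_intro.
- split.
    by rewrite /ultra_prod => /filter_ex[d /filter_ex[]].
  split.
  + by apply: filterS (@filterT _ r _) => d _; exact: filterT.
  + rewrite /ultra_prod => A B rA rB.
    by apply: filterS (filterI rA rB) => d [UA UB]; exact: filterI.
  + rewrite /ultra_prod => A B AB.
    by apply: filterS => d; apply: filterS => e; exact: AB.
- move=> A.
  have [|nr] := in_ultra_setVsetC (fun d => U (fun e => A (tcat e d))) rU; first by left.
  by right; apply: filterS nr => d; exact: ultraC.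
Qed.

Lemma removable_add E Y (U : set_system (tup N E)) (R : tup N X -> tup N E -> Prop)
    (phi : tup N X -> tup N Y -> Prop) (beta beta' : tup N E -> tup N Y) :
  UltraFilter U -> definable_rel R -> definable_rel phi ->
  reindex_map beta -> reindex_map beta' ->
  (forall B, definable B -> U (beta @^-1` B) -> U (beta' @^-1` B)) ->
  ~ shatters_arbitrarily_many phi ->
  removable U R ->
  removable U (fun x e => R x e \/ ~ (phi x (beta e) <-> phi x (beta' e))).
Proof.
move=> UU dR dphi Hb Hb' agree nip HR.
pose r := fmap beta U.
have rU : UltraFilter r by exact: ultra_fmap.
pose V := ultra_prod U r.
have VU : UltraFilter V by exact: ultra_prodP.
have dalt (g : tup N E -> tup N Y) : reindex_map g ->
    definable_rel (fun x (w : tup N (CCat E Y)) => ~ (phi x (g (tfst w)) <-> phi x (tsnd w))).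
  move=> [s [Hs _]].
  have H1 : definable (fun z : tup N (CCat X (CCat E Y)) => phi (tfst z) (g (tfst (tsnd z)))).
    apply: definable_comp2 dphi _ _; first by reindex.
    by exists (fun v => tsubst (fun w => tsubst (varr (X := X)) (varl (Y := Y) w)) (s v));
      split=> z; rewrite Hs; apply: functional_extensionality_dep => v;
      rewrite eval_subst.
  have H2 : definable (fun z : tup N (CCat X (CCat E Y)) => phi (tfst z) (tsnd (tsnd z))).
    by apply: definable_comp2 dphi _ _; reindex.
  exact: codefinable_not (codefinable_and (codefinable_imp H1 H2) (codefinable_imp H2 H1)).
(* One half of the exclusive disjunction, comparing [d] with [g e]; it is applied to [beta] and then
   to [beta']. *)
have half (g : tup N E -> tup N Y) (Q : tup N X -> tup N (CCat E Y) -> Prop) :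
    reindex_map g -> (forall B, definable B -> U (g @^-1` B) -> r B) ->
    definable_rel Q -> removable V Q ->
    removable V (fun x w => Q x w \/ ~ (phi x (g (tfst w)) <-> phi x (tsnd w))).
  move=> Hg gr dQ HQ.
  have [|W [WU VW Wg Wd]] := @ultra_amalgam _ _ V r (fun w => g (tfst w)) (@tsnd _ _ _ _) VU rU.
    move=> A B dA VA rB.
    (* For a suitable [d] in [B], the image under [g] of the slice of [A] at [d] is definable and so
       belongs to [r]; it therefore meets [B]. *)
    have [d [Ud Bd]] := filter_ex (filterI (VA : r (fun d => U (fun e => A (tcat e d)))) rB).
    have dC : definable (fun y => exists e, g e = y /\ A (tcat e d)).
      by apply: definable_image => //; exact: codefinable_section.
    have : r (fun y => exists e, g e = y /\ A (tcat e d)).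
      by apply: gr => //; apply: filterS Ud => e Ae; exists e.
    by move=> /filterI/(_ rB)/filter_ex[_ [[e [<- Ae]] Be]]; exists (tcat e d).
  have [k Hk] := alternation_exhausts rU WU (tup_inh N Y) Wg Wd nip.
  have WV A : definable A -> W A -> V A.
    move=> dA WA; apply: contrapT => /(ultraC VU)/(VW _ (codefinable_not dA)).
    by move=> /ultraCN; apply.
  (* The exhaustion takes place in [W], which has the same definable sets as [V], so removability
     passes from [V] to [W] and back. *)
  apply: (removable_agree WU VU WV).
  apply: removable_or Hk => //; first exact: dalt.
  exact: (removable_agree VU WU VW).
apply: (removable_drop (V := V)).
  move=> A dA UA; rewrite /V /ultra_prod.
  by apply: filterS (@filterT _ r _) => d _; exact: UA.
have HR' : removable V (fun x w => R x (tfst w)).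
  apply: removable_lift HR => A dA; rewrite /V /ultra_prod.
  by move=> /filter_ex[].
have dR' : definable_rel (fun x (w : tup N (CCat E Y)) => R x (tfst w)).
  by apply: definable_comp2 dR _ _; reindex.
have H1 := half beta _ Hb (fun B _ => id) dR' HR'.
have agree' B : definable B -> U (beta' @^-1` B) -> r B.
  move=> dB UB; apply: contrapT => /(ultraC rU) /(agree _ (codefinable_not dB)) K.
  exact: (ultraCN _ K UB).
have H2 := half beta' _ Hb' agree' (codefinable_or dR' (dalt _ Hb)) H1.
(* If [phi] differs at [beta] and [beta'], then one of these values differs from the value at
   [d]. *)
apply: removable_sub H2 => x w [Rx|nx]; first by left; left.
have [p|np] := pselect (phi x (tsnd w)); last first.
  have [q|nq] := pselect (phi x (beta (tfst w))); tauto.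
have [q|nq] := pselect (phi x (beta (tfst w))); tauto.
Qed.

End Removable.

Lemma filter_finite_forall T I (F : set_system T) (D : set I) (P : I -> set T) :
  Filter F -> finite_set D -> (forall i, D i -> F (P i)) ->
  F (fun x => forall i, D i -> P i x).
Proof.
move=> FF /(@finite_seqP {classic I})[s ->]; elim: s => [|i s IH] H.
  by apply: filterS (@filterT _ F _) => x _ i; rewrite /= in_nil.
have Hi : F (P i) by apply: H; rewrite /= mem_head.
have Hs : F (fun x => forall j, [set` s] j -> P j x).
  by apply: IH => j js; apply: H; rewrite /= inE js orbT.
apply: filterS (filterI Hi Hs) => x [Pi Ps] j; rewrite /= inE => /orP[/eqP->//|].
exact: Ps.
Qed.

(** * Ultrapowers over the natural numbers, and dependence *)

Section Ultrapower.
Variables (L : signature) (N : structure L) (V : set_system nat).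
Hypothesis V_ultra : UltraFilter V.
Implicit Types X Y : ctx (lsort L).

Definition germ s (g : nat -> N s) : set (nat -> N s) :=
  fun h => V (fun n => g n = h n).

Definition germs s : Type := {A : set (nat -> N s) | exists g, A = germ g}.

Definition to_germ s (g : nat -> N s) : germs s := exist _ (germ g) (ex_intro _ g erefl).

Definition germ_repr s (q : germs s) : nat -> N s := projT1 (cid (proj2_sig q)).

Lemma germ_reprK s (q : germs s) : to_germ (germ_repr q) = q.
Proof.
case: q => A HA; apply: eq_exist => /=.
by rewrite /germ_repr /=; case: (cid _) => g /= ->.
Qed.

Lemma to_germP s (g h : nat -> N s) :
  to_germ g = to_germ h <-> V (fun n => g n = h n).
Proof.
split=> [[/(congr1 (fun A : set (nat -> N s) => A h)) E]|gh].
  by change (germ g h); rewrite E; apply: filterS (@filterT _ V _).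
apply: eq_exist; rewrite predeqE => k; rewrite /germ; split=> H.
  by apply: filterS (filterI gh H) => n [<- <-].
by apply: filterS (filterI gh H) => n [-> <-].
Qed.

Lemma germ_repr_ae s (g : nat -> N s) : V (fun n => germ_repr (to_germ g) n = g n).
Proof. by apply/to_germP; rewrite germ_reprK. Qed.

Lemma germs_inh s : inhabited (germs s).
Proof. by have [z] := carrier_inh N s; exists; exact: (to_germ (fun=> z)). Qed.

Definition ultrapower : structure L :=
  @Structure L germs germs_inh
    (fun f a => to_germ (fun n => fint (fun v => germ_repr (a v) n)))
    (fun r a => V (fun n => rint (fun v => germ_repr (a v) n))).

Definition tup_germ X (a : nat -> tup N X) : tup ultrapower X :=
  fun v => to_germ (fun n => a n v).

(** A shape has finitely many leaves, so finite intersections suffice. *)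
Lemma filter_var X (P : var X -> set nat) :
  (forall v, V (P v)) -> V (fun n => forall v, P v n).
Proof.
elim: X P => [|s|X IHX Y IHY] P H.
- by apply: filterS (@filterT _ V _) => n _ [].
- by apply: filterS (H tt) => n Pn [].
- have HX := IHX (fun v => P (inl v)) (fun v => H (inl v)).
  have HY := IHY (fun v => P (inr v)) (fun v => H (inr v)).
  by apply: filterS (filterI HX HY) => n [PX PY] [].
Qed.

Lemma eval_germ X s (t : term X s) (a : nat -> tup N X) :
  eval (tup_germ a) t = to_germ (fun n => eval (a n) t).
Proof.
elim: t => //= f u IH; apply/to_germP.
have H : V (fun n => forall v, germ_repr (eval (tup_germ a) (u v)) n = eval (a n) (u v)).
  by apply: filter_var => v; rewrite IH; exact: germ_repr_ae.
by apply: filterS H => n Hn; congr (fint _); exact: functional_extensionality_dep.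
Qed.

Lemma tcat_germ X s (a : nat -> tup N X) (w : nat -> N s) :
  tcat (tup_germ a) (@tone L ultrapower s (to_germ w)) =
  tup_germ (fun n => tcat (a n) (tone (w n))).
Proof. by apply: functional_extensionality_dep => -[]. Qed.

(** This is Łoś's theorem. *)
Lemma sat_ultrapower X (f : formula X) (a : nat -> tup N X) :
  sat f (tup_germ a) <-> V (fun n => sat f (a n)).
Proof.
elim: f a => [{}X|{}X s t1 t2|{}X r t|{}X g IHg h IHh|{}X s g IH] a /=.
- by split=> // /filter_ex[].
- by rewrite !eval_germ; exact: to_germP.
- have H : V (fun n => forall v, germ_repr (eval (tup_germ a) (t v)) n = eval (a n) (t v)).
    by apply: filter_var => v; rewrite eval_germ; exact: germ_repr_ae.
  have E n : (forall v, germ_repr (eval (tup_germ a) (t v)) n = eval (a n) (t v)) ->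
      (fun v => germ_repr (eval (tup_germ a) (t v)) n) = (fun v => eval (a n) (t v)).
    exact: functional_extensionality_dep.
  by split=> K; apply: filterS (filterI H K) => n [/E ->].
- rewrite IHg IHh; split=> [H|H Hg]; last first.
    by apply: filterS (filterI H Hg) => n [gh] /gh.
  have [Hg|/(ultraC V_ultra)] := pselect (V (fun n => sat g (a n))).
    by apply: filterS (H Hg).
  by apply: filterS => n ng /ng.
- split=> [H|H z]; last first.
    rewrite -(germ_reprK z) tcat_germ IH.
    by apply: filterS H => n; exact.
  (* At each index [w] is a counterexample to the universal formula whenever there is one. *)
  have /choice[w Hw] : forall n, exists w,
      sat g (tcat (a n) (tone w)) -> forall z, sat g (tcat (a n) (tone z)).
    move=> n.
    have [?|/existsNP[w nw]] := pselect (forall z, sat g (tcat (a n) (tone z))).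
      by have [z0] := carrier_inh N s; exists z0.
    by exists w.
  by have := H (to_germ w); rewrite tcat_germ IH; apply: filterS.
Qed.

End Ultrapower.

(** The independence property asks for one infinite sequence and a witness for every set of indices.
    Germs of ever longer shattered sequences, and of their witnesses, provide these in a
    nonprincipal ultrapower: the index [i] is handled at all stages [n > i]. *)
Lemma dependent_not_shatters (L : signature) (T : theory L) (N : structure L)
    (X Y : ctx (lsort L)) (f : formula (CCat X Y)) :
  dependent T -> models N T ->
  ~ shatters_arbitrarily_many (fun (x : tup N X) (y : tup N Y) => sat f (tcat x y)).
Proof.
move=> depT NT sh.
have [V [VU V_oo]] := ultraFilterLemma eventually_filter.
pose UP := ultrapower N V.
have UPT : models UP T.
  move=> g /NT Ng.
  have -> : tnil UP = tup_germ V (fun=> tnil N) by apply: functional_extensionality_dep => -[].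
  by rewrite sat_ultrapower; apply: filterS (@filterT _ V _).
(* [has_IP] shatters tuples in the first group of variables, here they are in the second. *)
pose swap := fsubst f (scat (varr (X := Y) (Y := X)) varl).
apply: (depT _ UPT _ _ swap).
have [y Hy] := choice sh.
have Hy' (n : nat) (S : set nat) : exists x : tup N X,
    forall j, (j < n)%N -> (sat f (tcat x (y n j)) <-> S j).
  have [x Hx] := Hy n (fun j => `[< S j >]); exists x => j jn.
  by rewrite Hx //; split=> /asboolP.
have [x Hx] := choice (fun nS : nat * set nat => Hy' nS.1 nS.2).
exists (fun i => tup_germ V (fun n => y n i)), (fun S => tup_germ V (fun n => x (n, S))).
move=> i S.
have -> : tcat (tup_germ V (fun n => y n i)) (tup_germ V (fun n => x (n, S))) =
    tup_germ V (fun n => tcat (y n i) (x (n, S))).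
  by apply: functional_extensionality_dep => -[].
rewrite sat_ultrapower.
have iV : V (fun n => (i < n)%N) by apply: V_oo; exists i.+1.
have E n : sat swap (tcat (y n i) (x (n, S))) <-> sat f (tcat (x (n, S)) (y n i)).
  rewrite /swap sat_subst.
  by have -> : (fun v => eval (tcat (y n i) (x (n, S))) (scat varr varl v)) =
    tcat (x (n, S)) (y n i) by apply: functional_extensionality_dep => -[].
split=> [K|Si].
  by have [n [ni /E /(Hx (n, S) i ni)]] := filter_ex (filterI iV K).
by apply: filterS iV => n ni; apply/E/(Hx (n, S) i ni).
Qed.

(** * Transfer between [M] and [C], and ultrafilters refining types over [M] *)

Section Elementary.
Variables (L : signature) (C : structure L) (M : substructure C).
Hypothesis M_elementary : elementary M.
Implicit Types X Y Z : ctx (lsort L).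

Local Notation N := (sub_structure M).

Definition sub_incl s (z : N s) : C s := proj1_sig z.

Local Notation codef := (@codefinable L N C sub_incl).

Definition to_sub Y (d : tup C Y) (Hd : tuple_in (dom M) d) : tup N Y :=
  fun v => exist _ (d v) (Hd v).

Lemma sub_val_in Y (d : tup N Y) : tuple_in (dom M) (sub_val d).
Proof. by move=> v; exact: proj2_sig (d v). Qed.

Lemma codef_val X (A : set (tup N X)) A' (a : tup N X) :
  codef A A' -> A a <-> A' (sub_val a).
Proof.
move=> [Y [f [d [H H']]]]; rewrite H H' M_elementary.
by have -> : sub_val (tcat a d) = tcat (sub_val a) (sub_val d)
  by apply: functional_extensionality_dep => -[].
Qed.

(** Elementarity is applied to the existential closure, a condition on the empty tuple. *)
Lemma codef_nonempty X (A : set (tup N X)) A' b :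
  codef A A' -> A' b -> exists a, A a.
Proof.
move=> HA A'b.
have H : codef (fun z : tup N (CCat CNil X) => A (tsnd z)) (fun z => A' (tsnd z)).
  by apply: codefinable_comp HA _; reindex.
by apply/(codef_val (tnil N) (codefinable_ex H)); exists b.
Qed.

Lemma definable_codef X (A : set (tup N X)) : definable A -> exists A', codef A A'.
Proof.
move=> [Y [f [d [H _]]]].
by exists (fun a => sat f (tcat a (sub_val d))), Y, f, d.
Qed.

Lemma codef_definable X (A : set (tup N X)) A' : codef A A' -> definable A.
Proof. by move=> [Y [f [d [H _]]]]; exists Y, f, d. Qed.

Lemma codef_section X Y (f : formula (CCat X Y)) (d : tup N Y) :
  codef (fun x => sat f (tcat x d)) (fun x => sat f (tcat x (sub_val d))).
Proof. by exists Y, f, d. Qed.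

(** The type of [b] over [M] is read through the traces of its formulas on tuples of [M]; [U] is to
    contain them all. *)
Definition realizes X (U : set_system (tup N X)) (b : tup C X) : Prop :=
  forall A A', codef A A' -> A' b -> U A.

Lemma realizes_codef X (U : set_system (tup N X)) b A A' :
  ProperFilter U -> realizes U b -> codef A A' -> U A -> A' b.
Proof.
move=> UP Ub HA UA; apply: contrapT => nA'b.
exact: (ultraCN UP (Ub _ _ (codefinable_not HA) nA'b) UA).
Qed.

(** By elementarity the type of [b] is finitely satisfiable in [M], so its traces generate a proper
    filter. *)
Lemma realized_ultra X (b : tup C X) :
  exists U : set_system (tup N X), UltraFilter U /\ realizes U b.
Proof.
pose G : set_system (tup N X) := fun S => exists A A',
  [/\ codef A A', A' b & A `<=` S].
have GP : ProperFilter G.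
  split.
    by move=> [A [A' [HA A'b A0]]]; have [a /A0] := codef_nonempty HA A'b.
  split.
  - by exists (fun=> True), (fun=> True); split=> //; exact: codefinable_true.
  - move=> S S' [A [A' [HA A'b AS]]] [B [B' [HB B'b BS]]].
    exists (fun x => A x /\ B x), (fun x => A' x /\ B' x); split=> //.
      exact: codefinable_and.
    by move=> x [/AS ? /BS ?].
  - move=> S S' SS' [A [A' [HA A'b AS]]]; exists A, A'; split=> //.
    exact: subset_trans SS'.
have [U [UU GU]] := ultraFilterLemma GP.
by exists U; split=> // A A' HA A'b; apply: GU; exists A, A'; split.
Qed.

Lemma realizes_tfst X Y (U : set_system (tup N (CCat X Y))) b :
  realizes U b -> realizes (fmap (@tfst _ _ _ _) U) (tfst b).
Proof.
move=> Ub A A' HA; apply: (Ub (fun z => A (tfst z)) (fun z => A' (tfst z))).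
by apply: codefinable_comp HA _; reindex.
Qed.

Lemma realizes_tsnd X Y (U : set_system (tup N (CCat X Y))) b :
  realizes U b -> realizes (fmap (@tsnd _ _ _ _) U) (tsnd b).
Proof.
move=> Ub A A' HA; apply: (Ub (fun z => A (tsnd z)) (fun z => A' (tsnd z))).
by apply: codefinable_comp HA _; reindex.
Qed.

Lemma same_type_codef Y (b b' : tup C Y) A A' :
  same_type (dom M) b b' -> codef A A' -> A' b -> A' b'.
Proof.
move=> bb' [Z [f [d [_ H]]]] /H K; apply/H.
by apply/(bb' (PF f (sub_val d))) => //; exact: sub_val_in.
Qed.

(** * Obstructions to an invariant heir *)

Variables (X : ctx (lsort L)) (a : tup C X).

Definition codef_rel Z (R : tup N X -> tup N Z -> Prop) (R' : tup C X -> tup C Z -> Prop) :=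
  codef (fun z : tup N (CCat X Z) => R (tfst z) (tsnd z)) (fun z => R' (tfst z) (tsnd z)).

(** The sets forced out of every heir of the type of [a]. *)
Definition unrepresented (B : set (tup C X)) : Prop :=
  exists Z (e : tup C Z) R R', [/\ codef_rel R R',
    forall m : tup N Z, ~ R' a (sub_val m) & forall x, B x -> R' x e].

Lemma unrepresentedU B1 B2 :
  unrepresented B1 -> unrepresented B2 -> unrepresented (B1 `|` B2).
Proof.
move=> [Z1 [e1 [R1 [R1' [H1 n1 B1R]]]]] [Z2 [e2 [R2 [R2' [H2 n2 B2R]]]]].
exists (CCat Z1 Z2), (tcat e1 e2),
  (fun x z => R1 x (tfst z) \/ R2 x (tsnd z)),
  (fun x z => R1' x (tfst z) \/ R2' x (tsnd z)); split.
- apply: codefinable_or.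
    by refine (codefinable_comp2 H1 _ _); reindex.
  by refine (codefinable_comp2 H2 _ _); reindex.
- by move=> m [/(n1 (tfst m))|/(n2 (tsnd m))].
- by move=> x [/B1R|/B2R]; [left|right].
Qed.

(** The sets forced out of every global type invariant over [M]. *)
Inductive alternating : set (tup C X) -> Prop :=
| alternating0 : alternating set0
| alternatingU Y (f : formula (CCat X Y)) b b' B :
    same_type (dom M) b b' -> alternating B ->
    alternating (fun x => B x \/ ~ (sat f (tcat x b) <-> sat f (tcat x b'))).

Lemma alternating_union B1 B2 : alternating B1 -> alternating B2 ->
  exists2 B, alternating B & B1 `|` B2 `<=` B.
Proof.
move=> H1 H2; elim: H1 => [|Y f b b' B bb' _ [B3 H3 B3s]].
  by exists B2 => // x [].
exists (fun x => B3 x \/ ~ (sat f (tcat x b) <-> sat f (tcat x b'))).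
  exact: alternatingU.
by move=> x [[Bx|nx]|B2x]; [left; apply: B3s; left|right|left; apply: B3s; right].
Qed.

Variable T : theory L.
Hypotheses (T_dependent : dependent T) (C_models : models C T).

Lemma sub_models : models N T.
Proof.
move=> f /C_models; rewrite M_elementary.
by have -> : sub_val (tnil N) = tnil C by apply: functional_extensionality_dep => -[].
Qed.

(** Each new pair [b, b'] is appended to the tuple [e]. Quantifying over every ultrafilter that
    refines the type of [e] lets the induction hypothesis apply to the projection of [U]. *)
Lemma alternating_removable B : alternating B ->
  exists Z (e : tup C Z) R R', [/\ codef_rel R R', forall x, B x -> R' x e &
    forall U : set_system (tup N Z), UltraFilter U -> realizes U e -> removable U R].
Proof.
elim=> [|Y f b b' {}B bb' _ [Z [e [R [R' [HR BR rR]]]]]].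
  exists CNil, (tnil C), (fun _ _ => False), (fun _ _ => False); split=> //.
    exact: codefinable_false.
  by move=> U UU _; exact: removable_false.
pose phi (K : structure L) (x : tup K X) (y : tup K Y) := sat f (tcat x y).
exists (CCat Z (CCat Y Y)), (tcat e (tcat b b')),
  (fun x w => R x (tfst w) \/ ~ (phi N x (tfst (tsnd w)) <-> phi N x (tsnd (tsnd w)))),
  (fun x w => R' x (tfst w) \/ ~ (phi C x (tfst (tsnd w)) <-> phi C x (tsnd (tsnd w)))).
have dphi : codef_rel (phi N) (phi C).
  apply: codefinable_iff (codefinable_sat _ f) _ _ => z; by rewrite /phi tcat_eta.
have HR1 : codef_rel (Z := CCat Z (CCat Y Y)) (fun x w => R x (tfst w)) (fun x w => R' x (tfst w)).
  by refine (codefinable_comp2 HR _ _); reindex.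
split.
- have H1 : codef_rel (Z := CCat Z (CCat Y Y)) (fun x w => phi N x (tfst (tsnd w)))
      (fun x w => phi C x (tfst (tsnd w))).
    by refine (codefinable_comp2 dphi _ _); reindex.
  have H2 : codef_rel (Z := CCat Z (CCat Y Y)) (fun x w => phi N x (tsnd (tsnd w)))
      (fun x w => phi C x (tsnd (tsnd w))).
    by refine (codefinable_comp2 dphi _ _); reindex.
  apply: codefinable_or => //; apply: codefinable_not.
  exact: codefinable_and (codefinable_imp H1 H2) (codefinable_imp H2 H1).
- by move=> x [/BR|]; [left|right].
- move=> U UU Ue.
  apply: (removable_add (beta := fun w => tfst (tsnd w)) (beta' := fun w => tsnd (tsnd w))) => //.
  + exact: codef_definable HR1.
  + exact: codef_definable dphi.
  + by reindex.
  + by reindex.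
  + move=> A /definable_codef[A' HA] UA.
    have A'b : A' b.
      have H := realizes_tfst (realizes_tsnd Ue).
      by apply: realizes_codef H HA UA.
    by apply: (realizes_tsnd (realizes_tsnd Ue) HA); exact: same_type_codef HA A'b.
  + exact: dependent_not_shatters T_dependent sub_models.
  + have UF : UltraFilter (fmap (@tfst _ _ _ _) U) by exact: ultra_fmap.
    have := rR _ UF (realizes_tfst Ue).
    exact: removable_lift.
Qed.

(** If the two sets covered everything, [e2] would lie in the definable set of those [z2] for which
    some [z1] makes [P] at [z1] and [R] at [z2] cover. Removability gives finitely many such [z2] in
    [M] whose [R]-fibres have no common point, although [a] lies in all of them. *)
Lemma unrepresented_alternating_proper B1 B2 :
  unrepresented B1 -> alternating B2 -> ~ (setT `<=` B1 `|` B2).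
Proof.
move=> [Z1 [e1 [P [P' [HP nP BP]]]]] /alternating_removable.
move=> [Z2 [e2 [R [R' [HR BR rR]]]]] cover.
have [U [UU Ue]] := realized_ultra (tcat e1 e2).
have VU : UltraFilter (fmap (@tsnd _ _ Z1 Z2) U) by exact: ultra_fmap.
pose D (K : structure L) (S : tup K X -> tup K Z1 -> Prop) (Q : tup K X -> tup K Z2 -> Prop)
  z2 := exists z1, forall x, S x z1 \/ Q x z2.
have HPQ : codef (fun w : tup N (CCat (CCat Z2 Z1) X) =>
      P (tsnd w) (tsnd (tfst w)) \/ R (tsnd w) (tfst (tfst w)))
    (fun w => P' (tsnd w) (tsnd (tfst w)) \/ R' (tsnd w) (tfst (tfst w))).
  apply: codefinable_or.
    by refine (codefinable_comp2 HP _ _); reindex.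
  by refine (codefinable_comp2 HR _ _); reindex.
have HD : codef (D N P R) (D C P' R') := codefinable_ex (codefinable_all HPQ).
have UD : fmap (@tsnd _ _ _ _) U (D N P R).
  apply: (realizes_tsnd Ue HD).
  by exists e1 => x; have [/BP|/BR] := cover x I; [left|right].
have HD0 : definable_rel (fun (_ : tup N CNil) => D N P R).
  apply: (codef_definable (A' := fun w => D C P' R' (tsnd w))).
  by apply: codefinable_comp HD _; reindex.
have [n Hn] := rR _ VU (realizes_tsnd Ue) _ _ HD0.
suff main m (W : set (tup N X)) W' : codef W W' -> W' a ->
    ~ coverable (D N P R) R m W.
  exact: main (codefinable_true _ X) I (Hn (tnil N) UD).
elim: m W W' => [|m IH] W W' HW W'a /=.
  by have [x Wx] := codef_nonempty HW W'a; apply/existsNP; exists x => /(_ Wx).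
(* Since [P'] fails at [a] for every [z1] in [M], if [a] were outside the fibre at [z2] it would
   escape the covering; by elementarity some tuple of [M] would escape it too. *)
move=> [z2 [z1 H]]; apply: IH (codefinable_and HW (codefinable_section z2 HR)) _.
split=> //; apply: contrapT => nR'a.
have Hor := codefinable_not (codefinable_or (codefinable_section z1 HP) (codefinable_section z2 HR)).
have [|x] := codef_nonempty (b := a) Hor; last by apply; exact: H.
by move=> [/(nP z1)|].
Qed.

(** The complements of the obstructions generate a filter, proper by the preceding lemma. An
    ultrafilter on tuples of [C] stands for the global type of the definable sets it contains. *)
Lemma exists_heir_invariant : exists V : set_system (tup C X),
  [/\ UltraFilter V, forall B, unrepresented B -> ~ V B &
  forall Y (f : formula (CCat X Y)) b b', same_type (dom M) b b' ->
    V (fun x => sat f (tcat x b)) -> V (fun x => sat f (tcat x b'))].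
Proof.
have un0 : unrepresented set0.
  exists CNil, (tnil C), (fun _ _ => False), (fun _ _ => False).
  by split; [exact: codefinable_false|move=> _|].
pose G : set_system (tup C X) := fun S => exists B1 B2,
  [/\ unrepresented B1, alternating B2 & ~` S `<=` B1 `|` B2].
have GP : ProperFilter G.
  split.
    move=> [B1 [B2 [H1 H2 cover]]]; apply: (unrepresented_alternating_proper H1 H2).
    by move=> x _; apply: cover.
  split.
  - by exists set0, set0; split; [exact: un0|exact: alternating0|rewrite setCT].
  - move=> S S' [B1 [B2 [H1 H2 HS]]] [B1' [B2' [H1' H2' HS']]].
    have [B3 H3 HB3] := alternating_union H2 H2'.
    exists (B1 `|` B1'), B3; split=> //; first exact: unrepresentedU.
    rewrite setCI => x [/HS[Bx|Bx]|/HS'[Bx|Bx]].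
    + by left; left.
    + by right; apply: HB3; left.
    + by left; right.
    + by right; apply: HB3; right.
  - move=> S S' SS' [B1 [B2 [H1 H2 HS]]]; exists B1, B2; split=> //.
    by apply: subset_trans HS; exact: subsetC.
have [V [VU GV]] := ultraFilterLemma GP; exists V; split=> //.
  move=> B HB VB; apply: (ultraCN (ultra_proper (F := V)) _ VB); apply: GV.
  by exists B, set0; split; [|exact: alternating0|rewrite setCK => x; left].
move=> Y f b b' bb' Vb.
have : V (fun x => sat f (tcat x b) <-> sat f (tcat x b')).
  apply: GV; exists set0, (fun x => set0 x \/ ~ (sat f (tcat x b) <-> sat f (tcat x b'))).
  split; [exact: un0|exact: alternatingU (alternating0)|].
  by move=> x nx; right; right.
by move=> /filterI/(_ Vb); apply: filterS => x [[]] H _ /H.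
Qed.

End Elementary.

Theorem corollary4p12 (L : signature) (T : theory L)
  (T_complete : complete_theory T)
  (T_dependent : dependent T)
  (T_eq : is_eq_theory T)
  (K : Type) (C : structure L) (C_monster : monster T K C)
  (M : substructure C) (M_elementary : elementary M)
  (M_small : card_lt (dom M) (@setT K))
  (X : ctx (lsort L)) (p : set (pformula C X))
  (p_type : complete_type (dom M) p) :
  exists q : set (pformula C X),
    complete_type setT q /\ heir (dom M) p q /\ ~ forks (dom M) q.
Proof.
(* By saturation [p] is realized by some [a], and membership in [p] becomes truth at [a]. *)
have [a Ha] := monster_saturated C_monster M_small p_type.
have pE psi : over_set (dom M) psi -> psat a psi -> p psi.
  by move=> /(ct_complete p_type)[//|/Ha na] /na.
have [V [VU VN Vinv]] :=
  exists_heir_invariant M_elementary a T_dependent (monster_models C_monster).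
have VF : Filter V by exact: filter_filter.
exists (fun psi => V (fun x => psat x psi)); split; [split|split].
- by [].
- move=> S finS Sq.
  by have [x Hx] := filter_ex (filter_finite_forall VF finS Sq); exists x.
- by move=> psi _; exact: in_ultra_setVsetC.
- split.
    move=> [Y f d] pd; have Md := ct_over p_type pd.
    (* The negation of a formula of [p] fails at [a], hence is unrepresented, with the empty tuple
       as parameter. *)
    apply: contrapT => /(ultraC VU); apply: VN.
    exists CNil, (tnil C), (fun x _ => ~ sat f (tcat x (to_sub Md))),
      (fun x _ => ~ sat f (tcat x d)); split=> //.
    + apply: codefinable_not; apply: (codefinable_comp (codef_section f (to_sub Md))).
      by reindex.
    + by move=> _; apply; exact: (Ha _ pd).
  (* A formula of [q] with no instance from [M] in [p] would define an unrepresented set, as all its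
     instances from [M] fail at [a]. *)
  move=> Y Z f d Md c qc; apply: contrapT => nom; apply: VN qc.
  exists Y, c, (fun x y => sat f (tcat x (tcat y (to_sub Md)))),
    (fun x y => sat f (tcat x (tcat y d))); split=> //.
  + have H : codefinable (@sub_incl L C M)
        (fun w : tup (sub_structure M) (CCat (CCat X Y) Z) =>
           sat f (tcat (tfst (tfst w)) (tcat (tsnd (tfst w)) (tsnd w))))
        (fun w => sat f (tcat (tfst (tfst w)) (tcat (tsnd (tfst w)) (tsnd w)))).
      by apply: codefinable_comp (codefinable_sat _ f) _; reindex.
    exact: codefinable_section (to_sub Md) H.
  + move=> m sm; apply: nom; exists (sub_val m); first exact: sub_val_in.
    apply: pE => // -[y|z]; [exact: (sub_val_in m y)|exact: Md].
- move=> [S [D [finS Sq finD Ddiv SD]]].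
  (* An ultrafilter containing a finite union contains one of its members, so [q] would contain a
     dividing formula. *)
  have [psi [Dpsi Vpsi]] : exists psi, D psi /\ V (fun x => psat x psi).
    apply: contrapT => /forallNP nD.
    have H1 := filter_finite_forall VF finS Sq.
    have H2 : V (fun x => forall psi, D psi -> ~ psat x psi).
      apply: (filter_finite_forall (P := fun psi x => ~ psat x psi)) => // psi Dpsi.
      by apply: (ultraC VU) => Vpsi; exact: (nD psi (conj Dpsi Vpsi)).
    have [x [/SD[psi Dpsi xpsi] nx]] := filter_ex (filterI H1 H2).
    exact: nx xpsi.
  have [k [b [bpsi inc]]] := Ddiv _ Dpsi.
  (* By invariance [q] contains the formula at every [b i], so the first [k] instances have a common
     solution. *)
  apply: (inc (fun i => i) (@val_inj _ _ _)).
  have : V (fun x => forall i : 'I_k, sat (pform psi) (tcat x (b i))).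
    apply: filter_forall => i; apply: Vinv Vpsi => chi ov.
    by split=> /(bpsi i chi ov).
  by move=> /filter_ex[x Hx]; exists x.
Qed.
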